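(* Suppose that the following statement (the $q$-rious unimodality conjecture) is true: for all tuples of positive integers $\boldsymbol{a}=(a_1,\dotsc,a_r)$ and $\boldsymbol{b}=(b_1,\dotsc,b_s)$ satisfying \[ \sum_{i=1}^r\lfloor a_ix\rfloor-\sum_{j=1}^s\lfloor b_jx\rfloor\geq 0\quad\text{for all real } x\geq 0, \] the polynomial $(1+q)\,D(\boldsymbol{a},\boldsymbol{b};q)$ is unimodal. Then the following statement (the $q$-rious positivity conjecture) is true: for all tuples of positive integers $\boldsymbol{a}=(a_1,\dotsc,a_r)$ and $\boldsymbol{b}=(b_1,\dotsc,b_s)$ satisfying \[ \sum_{i=1}^r\lfloor a_ix\rfloor-\sum_{j=1}^s\lfloor b_jx\rfloor\geq 0\quad\text{for all real } x\geq 0, \] the polynomial $D(\boldsymbol{a},\boldsymbol{b};q)$ is positive.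
   Context: For a nonnegative integer $n$, $[n]=(1-q^n)/(1-q)$ and $[n]!=[1][2]\dotsm[n]$, with the empty product equal to $1$. For tuples of positive integers $\boldsymbol{a}=(a_1,\dotsc,a_r)$ and $\boldsymbol{b}=(b_1,\dotsc,b_s)$, \[ D(\boldsymbol{a},\boldsymbol{b};q)=\frac{[a_1]!\dotsm[a_r]!}{[b_1]!\dotsm[b_s]!}. \] It is known that if $\sum_{i=1}^r\lfloor a_ix\rfloor-\sum_{j=1}^s\lfloor b_jx\rfloor\geq 0$ for all $x\geq 0$, then $D(\boldsymbol{a},\boldsymbol{b};q)\in\mathbb{Z}[q]$; moreover, in that case $D(\boldsymbol{a},\boldsymbol{b};q)=\sum_{i=0}^k c_iq^i$ with $k=\sum_i\binom{a_i}{2}-\sum_j\binom{b_j}{2}$, $c_0=1$ and $c_i=c_{k-i}$ for all $0\leq i\leq k$. A nonzero polynomial $c_0+c_1q+\dotsb+c_kq^k\in\mathbb{Z}[q]$ is called positive if $c_i\geq 0$ for all $i$. A polynomial $P(q)=\sum_{i=0}^k c_iq^i$ of degree $k$ whose coefficients are symmetric, i.e., $c_i=c_{k-i}$ for all $0\leq i\leq k$ (as is the case for $(1+q)D(\boldsymbol{a},\boldsymbol{b};q)$), is called unimodal if $c_0\leq c_1\leq\dotsb\leq c_{\lfloor k/2\rfloor}$. *)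

(* Defs.v *)
From HB Require Import structures.
From mathcomp Require Import all_boot all_order all_algebra.
From mathcomp Require Import reals.

Set Implicit Arguments.
Unset Strict Implicit.
Unset Printing Implicit Defensive.

Import Order.TTheory GRing.Theory Num.Theory.
Local Open Scope ring_scope.

Local Notation tofrac := (@FracField.tofrac {poly int}).

Definition q : {fraction {poly int}} := tofrac 'X.

Definition qint (n : nat) : {fraction {poly int}} := (1 - q ^+ n) / (1 - q).

Definition qfact (n : nat) : {fraction {poly int}} :=
  \prod_(1 <= i < n.+1) qint i.

Definition D (a b : seq nat) : {fraction {poly int}} :=
  (\prod_(i <- a) qfact i) / (\prod_(j <- b) qfact j).

Definition positive_tuple (a : seq nat) : bool := all (fun i => 0 < i)%N a.

Definition floor_condition (R : realType) (a b : seq nat) : Prop :=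
  forall x : R, 0 <= x ->
    0 <= \sum_(i <- a) Num.floor (i%:R * x)
         - \sum_(j <- b) Num.floor (j%:R * x).

Definition positive_poly (P : {poly int}) : Prop :=
  P != 0 /\ forall i : nat, 0 <= P`_i.

(* The notion is meant for polynomials with symmetric coefficients. Symmetry
   is not a conjunct: under floor_condition it holds for (1 + q) D(a, b; q), the
   only polynomial the notion is applied to. *)
Definition unimodal_poly (P : {poly int}) : Prop :=
  let k := (size P).-1 in
  forall i : nat, (i < k./2)%N -> P`_i <= P`_i.+1.

Definition q_rious_unimodality (R : realType) : Prop :=
  forall a b : seq nat,
    positive_tuple a -> positive_tuple b -> floor_condition R a b ->
    exists2 P : {poly int}, (1 + q) * D a b = tofrac P & unimodal_poly P.

Definition q_rious_positivity (R : realType) : Prop :=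
  forall a b : seq nat,
    positive_tuple a -> positive_tuple b -> floor_condition R a b ->
    exists2 P : {poly int}, D a b = tofrac P & positive_poly P.

(* Main.v *)
Require Import Defs.
From mathcomp Require Import all_boot all_order all_algebra reals.
From mathcomp Require Import ring lra zify.
From HB Require Import structures.

(** Unimodality of [(1 + q) D] says [d_i >= d_(i-2)] for the coefficients [d_i]
    of [D], as long as [i] is at most about half the degree. Starting from
    [d_(-1) = 0] and [d_0 = 1], this makes the lower half of the coefficients
    nonnegative, and the upper half follows because [D] is palindromic.

    Polynomiality of [D] itself only needs one root to be examined: since
    [(1 + q) D] is a polynomial by hypothesis, it suffices that [-1] is not a
    pole of [D]. As [-1] is a root of [[n]!] of multiplicity [n./2], this is
    the floor condition at [x = 1/2]. *)

Set Implicit Arguments.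
Unset Strict Implicit.
Unset Printing Implicit Defensive.

Import Order.TTheory GRing.Theory Num.Theory.
Local Open Scope ring_scope.

(** * Reversal of polynomials *)

Section Reverse.
Variable R : idomainType.
Implicit Types p q : {poly R}.

(** For nonzero [p] of degree d this is X^d p(1/X); the palindromic polynomials are its fixed
    points. *)
Definition revp p := \poly_(i < size p) p`_((size p).-1 - i).

(** Fixing the nominal degree [n] makes reversal linear, which [revp] is not. *)
Definition revp_at n p := \poly_(i < n.+1) p`_(n - i).

Lemma coef_revp_at n p i : (revp_at n p)`_i = if (i <= n)%N then p`_(n - i) else 0.
Proof. by rewrite coef_poly ltnS. Qed.

Lemma revp_at_is_linear n : linear (revp_at n).
Proof.
move=> c p1 p2; apply/polyP=> i.
rewrite coefD coefZ !coef_revp_at coefD coefZ.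
by case: ifP => // _; rewrite mulr0 addr0.
Qed.

HB.instance Definition _ n :=
  GRing.isLinear.Build R {poly R} {poly R} _ (revp_at n) (revp_at_is_linear n).

Lemma revp_atXn n i : (i <= n)%N -> revp_at n 'X^i = 'X^(n - i).
Proof.
move=> le_in; apply/polyP=> j; rewrite coef_revp_at !coefXn.
case: ifP => le_jn; last by case: eqP => // ?; lia.
by congr (nat_of_bool _)%:R; lia.
Qed.

Lemma poly_expand n p : (size p <= n)%N -> p = \sum_(i < n) p`_i *: 'X^i.
Proof.
move=> le_pn; rewrite -poly_def; apply/polyP=> i; rewrite coef_poly.
by case: ltnP => // le_ni; rewrite nth_default // (leq_trans le_pn).
Qed.

Lemma revp_atE n p : (size p <= n.+1)%N ->
  revp_at n p = \sum_(i < n.+1) p`_i *: 'X^(n - i).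
Proof.
move=> /poly_expand {1}->; rewrite linear_sum; apply: eq_bigr => i _.
by rewrite linearZ /= revp_atXn // -ltnS.
Qed.

(** Both sides are bilinear, which reduces the identity to monomials. *)
Lemma revp_atM m n p q : (size p <= m.+1)%N -> (size q <= n.+1)%N ->
  revp_at (m + n) (p * q) = revp_at m p * revp_at n q.
Proof.
move=> le_pm le_qn; rewrite (revp_atE le_pm) (revp_atE le_qn).
rewrite {1}(poly_expand le_pm) {1}(poly_expand le_qn) !mulr_suml linear_sum.
apply: eq_bigr => i _; rewrite !mulr_sumr linear_sum; apply: eq_bigr => j _.
rewrite -!scalerAl -!scalerAr !linearZ /= -!exprD revp_atXn; last first.
  by apply: leq_add; rewrite -ltnS.
rewrite !scalerA [q`_j * _]mulrC; congr (_ *: 'X^_).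
by case: i j => [i ?] [j ?] /=; lia.
Qed.

Lemma revpE p : p != 0 -> revp p = revp_at (size p).-1 p.
Proof. by move=> p0; rewrite /revp /revp_at prednK // size_poly_gt0. Qed.

Lemma revpM p q : p != 0 -> q != 0 -> revp (p * q) = revp p * revp q.
Proof.
move=> p0 q0; rewrite !revpE ?mulf_neq0 // size_mul //.
have sp : (0 < size p)%N by rewrite size_poly_gt0.
have sq : (0 < size q)%N by rewrite size_poly_gt0.
by rewrite -revp_atM ?prednK //; congr (revp_at _ _); lia.
Qed.

Lemma revp_quotient p q : q != 0 -> revp q = q -> revp (p * q) = p * q ->
  revp p = p.
Proof.
move=> q0 rq; have [->|p0] := eqVneq p 0.
  by move=> _; rewrite /revp size_poly0 poly_def big_ord0.
by rewrite revpM // rq; apply: mulIf.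
Qed.

End Reverse.

(** * Multiplicity of the root -1 *)

Definition order_at_m1 (A : {poly int}) (m : nat) :=
  exists2 p : {poly int}, A = (1 + 'X) ^+ m * p & p.[-1] != 0.

Lemma order_at_m1M A B m n :
  order_at_m1 A m -> order_at_m1 B n -> order_at_m1 (A * B) (m + n).
Proof.
move=> [p -> p0] [r -> r0]; exists (p * r); first by rewrite exprD; ring.
by rewrite hornerM mulf_neq0.
Qed.

Lemma order_at_m1_prod (s : seq nat) (F : nat -> {poly int}) (e : nat -> nat) :
  (forall i, order_at_m1 (F i) (e i)) ->
  order_at_m1 (\prod_(i <- s) F i) (\sum_(i <- s) e i)%N.
Proof.
move=> FE; elim: s => [|i s IH]; last by rewrite !big_cons; apply: order_at_m1M.
by rewrite !big_nil; exists 1; rewrite ?expr0 ?mulr1 // hornerE.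
Qed.

Lemma onePX_neq0 : (1 + 'X : {poly int}) != 0.
Proof. by rewrite addrC -[1]opprK -polyCN polyXsubC_eq0. Qed.

(** After cancelling (1 + X)^n the left side still vanishes at -1, while the cofactor of [B] does
    not; hence -1 is a root of [P]. *)
Lemma dvd_onePX (P A B : {poly int}) m n : (n <= m)%N ->
  order_at_m1 A m -> order_at_m1 B n -> (1 + 'X) * A = P * B ->
  exists Q : {poly int}, P = (1 + 'X) * Q.
Proof.
move=> le_nm [A' -> _] [B' -> B'0] PE.
have {PE} PE : (1 + 'X) ^+ (m - n).+1 * A' = P * B'.
  have nz : (1 + 'X) ^+ n != 0 :> {poly int} by rewrite expf_neq0 ?onePX_neq0.
  apply: (mulfI nz); rewrite [RHS]mulrCA -PE !mulrA -exprD -exprS.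
  by rewrite addnS subnKC.
have /factor_theorem [Q ->] : root P (-1).
  have := congr1 (horner^~ (-1)) PE.
  rewrite !hornerM horner_exp !hornerE subrr expr0n !mul0r => /esym/eqP.
  by rewrite mulf_eq0 (negPf B'0) orbF.
by exists Q; rewrite polyCN opprK mulrC addrC.
Qed.

(** * q-integers and q-factorials as polynomials *)

Definition qintp (n : nat) : {poly int} := \sum_(i < n) 'X^i.

Definition qfactp (n : nat) : {poly int} := \prod_(1 <= i < n.+1) qintp i.

Local Notation tofrac := (@FracField.tofrac {poly int}).

Lemma qintE n : qint n = tofrac (qintp n).
Proof.
have q1 : 1 - q != 0.
  rewrite /q -tofrac1 -tofracB tofrac_eq0 subr_eq0 eq_sym -subr_eq0.
  by rewrite -polyC1 polyXsubC_eq0.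
apply: (mulIf q1); rewrite /qint mulfVK // /q -tofrac1 -tofracXn -!tofracB.
by rewrite -tofracM -[1 - 'X]opprB mulrN mulrC -subrX1 opprB.
Qed.

Lemma qfactE n : qfact n = tofrac (qfactp n).
Proof.
by rewrite /qfact /qfactp rmorph_prod; apply: eq_bigr => i _; rewrite qintE.
Qed.

Lemma DE a b :
  D a b = tofrac (\prod_(i <- a) qfactp i) / tofrac (\prod_(i <- b) qfactp i).
Proof.
by rewrite /D !rmorph_prod; congr (_ / _); apply: eq_bigr => i _; rewrite qfactE.
Qed.

Lemma qintp_poly n : qintp n = \poly_(i < n) 1.
Proof. by rewrite poly_def; apply: eq_bigr => i _; rewrite scale1r. Qed.

Lemma size_qintp n : size (qintp n) = n.
Proof. by rewrite qintp_poly size_poly_eq ?oner_neq0. Qed.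

Lemma coef_qintp n i : (qintp n)`_i = (i < n)%:R.
Proof. by rewrite qintp_poly coef_poly; case: ltnP. Qed.

Lemma revp_qintp n : revp (qintp n) = qintp n.
Proof.
apply/polyP=> i; rewrite coef_poly size_qintp !coef_qintp.
by case: ltnP => // lt_in; congr (nat_of_bool _)%:R; lia.
Qed.

Lemma order_qintp n : order_at_m1 (qintp n.+1) (odd n).
Proof.
have value k : (qintp k).[-1] = (odd k)%:R.
  elim: k => [|k IH]; first by rewrite /qintp big_ord0 horner0.
  rewrite /qintp big_ord_recr /= hornerD IH hornerXn -signr_odd.
  by case: (odd k).
case/boolP: (odd n) => on; last first.
  by exists (qintp n.+1); rewrite ?expr0 ?mul1r // value /= on.
have [k ->] : exists k, n = k.*2.+1.
  by exists n./2; rewrite -[n in LHS]odd_double_half on.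
(* Pairing consecutive powers gives [2k+2]_q = (1 + q) [k+1]_(q^2); the second factor takes the
   value k+1 at -1. *)
exists (\sum_(i < k.+1) 'X^(i.*2)).
  rewrite expr1; elim: k => [|k IH].
    by rewrite /qintp !big_ord_recr !big_ord0 /= !add0r mulr1.
  rewrite /qintp doubleS 2!big_ord_recr /= -/(qintp _) IH [in RHS]big_ord_recr /=.
  by rewrite doubleS !exprS !mulrDr; ring.
rewrite horner_sum (eq_bigr (fun=> 1)).
  by rewrite sumr_const card_ord pnatr_eq0.
by move=> i _; rewrite hornerXn -signr_odd odd_double.
Qed.

Lemma qfactpS n : qfactp n.+1 = qfactp n * qintp n.+1.
Proof. by rewrite /qfactp big_nat_recr. Qed.

Lemma qfactp0 : qfactp 0 = 1.
Proof. by rewrite /qfactp big_geq. Qed.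

(** Each even index up to [n] contributes one simple root, and odd indices contribute none. *)
Lemma order_qfactp n : order_at_m1 (qfactp n) n./2.
Proof.
elim: n => [|n IH].
  by rewrite qfactp0; exists 1; rewrite ?expr0 ?mulr1 // hornerE.
rewrite qfactpS (_ : n.+1./2 = n./2 + odd n)%N; last by rewrite /= uphalf_half addnC.
by apply: order_at_m1M IH _; apply: order_qintp.
Qed.

(* The condition on the constant coefficient also guarantees [A != 0], which
   makes the property stable under products. *)
Definition palin1 (A : {poly int}) := revp A = A /\ A`_0 = 1.

Lemma palin1_neq0 A : palin1 A -> A != 0.
Proof.
by case=> _ A0; apply: contra_eq_neq A0 => ->; rewrite coef0 eq_sym oner_neq0.
Qed.

Lemma palin1M A B : palin1 A -> palin1 B -> palin1 (A * B).
Proof.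
move=> pA pB; have A0 := palin1_neq0 pA; have B0 := palin1_neq0 pB.
case: pA pB => rA A1 [rB B1]; split; first by rewrite revpM // rA rB.
by rewrite coef0M A1 B1 mulr1.
Qed.

Lemma palin1_1 : palin1 1.
Proof.
split; last by rewrite coef1.
apply/polyP=> i; rewrite coef_poly size_poly1 coef1.
by case: i => [|i] //=; rewrite coef1.
Qed.

Lemma palin1_qfactp n : palin1 (qfactp n).
Proof.
elim: n => [|n IH]; first by rewrite qfactp0; apply: palin1_1.
rewrite qfactpS; apply: palin1M => //.
by split; [apply: revp_qintp | rewrite coef_qintp].
Qed.

Lemma palin1_prod_qfactp (s : seq nat) : palin1 (\prod_(i <- s) qfactp i).
Proof.
elim: s => [|i s IH]; first by rewrite big_nil; apply: palin1_1.
by rewrite big_cons; apply: palin1M => //; apply: palin1_qfactp.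
Qed.

(** * The floor condition at 1/2 *)

Lemma floor_half (R : realType) n :
  Num.floor (n%:R * 2^-1 : R) = (n./2)%:Z.
Proof.
apply: floor_def; rewrite intrD -!pmulrn.
have -> : (n%:R : R) = (odd n)%:R + n./2%:R * 2.
  by rewrite -[n in LHS]odd_double_half natrD -muln2 natrM.
by case: (odd n) => /=; lra.
Qed.

Lemma floor_condition_half (R : realType) a b : floor_condition R a b ->
  (\sum_(j <- b) j./2 <= \sum_(i <- a) i./2)%N.
Proof.
move/(_ 2^-1); rewrite invr_ge0 ler0n => /(_ isT).
have sumE s : \sum_(i <- s) Num.floor (i%:R * 2^-1 : R) = (\sum_(i <- s) i./2)%N%:Z.
  by rewrite -[RHS]natz natr_sum; apply: eq_bigr => i _; rewrite floor_half natz.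
by rewrite !sumE subr_ge0 lez_nat.
Qed.

(** * From unimodality to positivity *)

Lemma unimodal_positive (Q : {poly int}) :
  palin1 Q -> unimodal_poly ((1 + 'X) * Q) -> positive_poly Q.
Proof.
move=> pQ; have Q0 := palin1_neq0 pQ; case: pQ => rQ Q1.
have sQ : (0 < size Q)%N by rewrite size_poly_gt0.
rewrite /unimodal_poly.
have -> : (size ((1 + 'X) * Q)).-1 = size Q.
  rewrite size_mul ?onePX_neq0 // addrC.
  by rewrite -[1]opprK -polyCN size_XsubC.
have coefP i : ((1 + 'X) * Q)`_i = Q`_i + (if i is j.+1 then Q`_j else 0).
  by rewrite mulrDl mul1r coefD coefXM; case: i.
move=> uni; split=> // i.
(* Unimodality reaches index [(size Q)./2], at least half the degree of [Q], so every larger index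
   up to the degree reflects into this range. *)
have low j : (j <= (size Q)./2)%N -> 0 <= Q`_j.
  elim/ltn_ind: j => -[|[|j]] IH le_j; first by rewrite Q1.
    by have := uni 0%N le_j; rewrite !coefP addr0; lra.
  (* The coefficient of [Q] of index j+1 occurs on both sides and cancels, which leaves a comparison
     of indices j and j+2. *)
  have := uni j.+1 le_j; rewrite !coefP addrC lerD2r; apply: le_trans.
  by apply: IH; lia.
case: (leqP i (size Q)./2) => [/low //|lt_i].
case: (ltnP i (size Q)) => [lt_iQ|le_Qi]; last by rewrite nth_default.
have le_half s : (s./2 < i)%N -> (s.-1 - i <= s./2)%N by lia.
by rewrite -{1}rQ coef_poly lt_iQ; apply: low; apply: le_half.
Qed.

Theorem lemma6 (R : realType) :
  q_rious_unimodality R -> q_rious_positivity R.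
Proof.
move=> U a b pos_a pos_b fab; have [P DP uniP] := U a b pos_a pos_b fab.
set A := \prod_(i <- a) qfactp i; set B := \prod_(i <- b) qfactp i.
have pA : palin1 A by apply: palin1_prod_qfactp.
have pB : palin1 B by apply: palin1_prod_qfactp.
have B0 := palin1_neq0 pB.
have FB0 : tofrac B != 0 by rewrite tofrac_eq0.
have PE : (1 + 'X) * A = P * B.
  apply/eqP; rewrite -tofrac_eq !tofracM -DP DE -/A -/B mulrA mulfVK //.
  by rewrite tofracD tofrac1.
have [Q PQ] := dvd_onePX (floor_condition_half fab)
  (order_at_m1_prod a order_qfactp) (order_at_m1_prod b order_qfactp) PE.
(* Cancelling 1 + X shows that [B] divides [A] over the integers, so [D a b] is the polynomial
   [Q]. *)
have AQ : A = Q * B by apply: (mulfI onePX_neq0); rewrite PE PQ mulrA.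
exists Q; first by rewrite DE -/A -/B AQ tofracM mulfK.
apply: unimodal_positive; last by rewrite -PQ.
(* Palindromicity and constant coefficient 1 pass from [A] and [B] to their quotient. *)
case: pA pB => rA A1 [rB B1]; split.
  by apply: revp_quotient B0 rB _; rewrite -AQ.
by move: A1; rewrite AQ coef0M B1 mulr1.
Qed.
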